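(* Let $K,N,M\in\mathbb N$, let $(\mu^{(k)},\nu^{(k)})\in\Delta_N\times\Delta_M$, $k\in\{1,\dots,K\}$, be $K$ distinct pairs of marginals, and let $\alpha^{(k)}\in\mathbb R$ (total costs) and $\pi^{(k)}\in\Pi(\mu^{(k)},\nu^{(k)})$ (optimal transport plans), $k\in\{1,\dots,K\}$, be observed with respect to an underlying cost matrix $c\in\mathbb R^{N\times M}$, i.e. $\mathcal T_c(\mu^{(k)},\nu^{(k)})=\alpha^{(k)}=\langle c,\pi^{(k)}\rangle$ for all $k$. For each $k$ let $\{u^{(\ell,k)}:\ell\in\{1,\dots,L_k\}\}\subseteq\operatorname{EP}(\mu^{(k)},\nu^{(k)})$ be a family of extreme points as described in the context. a) If the system $\{u^{(\ell,k)}:k\in\{1,\dots,K\},\ \ell\in\{1,\dots,L_k\}\}\subseteq\mathbb R^{N\times M}$ contains $NM$ linearly independent vectors, then the cost matrix $c$ is identifiable in $\mathbb R^{N\times M}$. b) Suppose that $\operatorname{conv}\{u^{(\ell,k)}:\ell\in\{1,\dots,L_k\}\}=\operatorname{OTP}_c(\mu^{(k)},\nu^{(k)})$ for all $k\in\{1,\dots,K\}$. Then the converse holds: if $c$ is identifiable in $\mathbb R^{N\times M}$, then $\{u^{(\ell,k)}:k\in\{1,\dots,K\},\ \ell\in\{1,\dots,L_k\}\}$ contains $NM$ linearly independent vectors.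
   Context: $\Delta_N=\{x\in\mathbb R^N: x_i\ge 0,\ \sum_i x_i=1\}$. For $\mu\in\Delta_N$, $\nu\in\Delta_M$, $\Pi(\mu,\nu)$ is the set of $N\times M$ matrices with nonnegative entries, row sums $\mu$ and column sums $\nu$; $\operatorname{EP}(\mu,\nu)$ is the finite set of its extreme points. For $c\in\mathbb R^{N\times M}$, $\mathcal T_c(\mu,\nu)=\min_{\pi\in\Pi(\mu,\nu)}\langle c,\pi\rangle$ ($\langle\cdot,\cdot\rangle$ the Frobenius inner product) and $\operatorname{OTP}_c(\mu,\nu)$ is the set of minimizers (optimal transport plans). Families $u^{(\ell,k)}$: for each $k$, $L_k\in\mathbb N$ and $u^{(1,k)},\dots,u^{(L_k,k)}\in\operatorname{EP}(\mu^{(k)},\nu^{(k)})$ are such that $\pi^{(k)}=\sum_{\ell=1}^{L_k}\lambda_\ell u^{(\ell,k)}$ for some $\lambda\in\Delta_{L_k}$ with all $\lambda_\ell>0$, and $\operatorname{conv}\{u^{(\ell,k)}:\ell\in\{1,\dots,L_k\}\}\subseteq\operatorname{OTP}_c(\mu^{(k)},\nu^{(k)})$. (Such families always exist, e.g. all vertices of the smallest face of $\Pi(\mu^{(k)},\nu^{(k)})$ containing $\pi^{(k)}$.) Here the observed information consists of the marginals, total costs and optimal transport plans. A cost matrix $\tilde c\in\mathbb R^{N\times M}$ is consistent if $\mathcal T_{\tilde c}(\mu^{(k)},\nu^{(k)})=\alpha^{(k)}=\langle\tilde c,\pi^{(k)}\rangle$ for all $k$. The cost matrix $c$ is identifiable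 in $\mathbb R^{N\times M}$ if $c$ is the only consistent cost matrix. *)

(* Defs.v *)
From mathcomp Require Import all_boot all_order all_algebra.
From mathcomp Require Import classical_sets reals.

Set Implicit Arguments.
Unset Strict Implicit.
Unset Printing Implicit Defensive.

Import Order.TTheory GRing.Theory Num.Theory.

Local Open Scope classical_set_scope.
Local Open Scope ring_scope.

Definition simplex (R : realType) (n : nat) : set 'rV[R]_n :=
  [set x | (forall i, 0 <= x 0 i) /\ \sum_i x 0 i = 1].
Arguments simplex : clear implicits.

Definition frob (R : realType) (N M : nat) (A B : 'M[R]_(N, M)) : R :=
  \sum_(i < N) \sum_(j < M) A i j * B i j.

Definition extreme_points (R : realType) (V : lmodType R) (A : set V) : set V :=
  [set x | A x /\
     forall (y z : V) (t : R), A y -> A z -> 0 < t -> t < 1 ->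
       x = t *: y + (1 - t) *: z -> y = z].

(* The convex hull of a finite family, as the set of its convex combinations. *)
Definition conv_family (R : realType) (V : lmodType R) (n : nat)
    (u : 'I_n -> V) : set V :=
  [set \sum_(l < n) lam 0 l *: u l | lam in simplex R n].

Definition is_minimum (R : realType) (A : set R) (t : R) : Prop :=
  A t /\ forall s, A s -> t <= s.

Section Transport.
Variables (R : realType) (N M : nat).
Implicit Types (c p : 'M[R]_(N, M)) (mu : 'rV[R]_N) (nu : 'rV[R]_M).

Definition couplings mu nu : set 'M[R]_(N, M) :=
  [set p | [/\ forall i j, 0 <= p i j,
               forall i, \sum_(j < M) p i j = mu 0 i
             & forall j, \sum_(i < N) p i j = nu 0 j]].

Definition EP mu nu : set 'M[R]_(N, M) := extreme_points (couplings mu nu).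

(* [is_transport_cost c mu nu t] reads T_c(mu, nu) = t; the value is determined
   by c, mu and nu since a minimum is unique. *)
Definition is_transport_cost c mu nu (t : R) : Prop :=
  is_minimum [set frob c p | p in couplings mu nu] t.

Definition OTP c mu nu : set 'M[R]_(N, M) :=
  [set p | couplings mu nu p /\
           forall q, couplings mu nu q -> frob c p <= frob c q].

Section Data.
Variables (K : nat) (mu : 'I_K -> 'rV[R]_N) (nu : 'I_K -> 'rV[R]_M).
Variables (alpha : 'I_K -> R) (pi : 'I_K -> 'M[R]_(N, M)).

Definition consistent c : Prop :=
  forall k, is_transport_cost c (mu k) (nu k) (alpha k)
            /\ alpha k = frob c (pi k).

Definition identifiable c : Prop := [set c' | consistent c'] = [set c].

End Data.

(* [u] is a family of extreme points of which [p] is a convex combination with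
   positive weights; [u] may have repetitions. *)
Definition plan_family c mu nu p (n : nat) (u : 'I_n -> 'M[R]_(N, M)) : Prop :=
  [/\ forall l, EP mu nu (u l),
      exists2 lam : 'rV[R]_n, simplex R n lam &
        (forall l, 0 < lam 0 l) /\ p = \sum_(l < n) lam 0 l *: u l
    & conv_family u `<=` OTP c mu nu].

(* Some [n] members of the system { u k l : k, l } are linearly independent. *)
Definition contains_free (K : nat) (L : 'I_K -> nat)
    (u : forall k : 'I_K, 'I_(L k) -> 'M[R]_(N, M)) (n : nat) : Prop :=
  exists s : n.-tuple 'M[R]_(N, M),
    free s /\ forall v, v \in s -> exists k (l : 'I_(L k)), v = u k l.

End Transport.

(* Main.v *)
Require Import Defs.
From HB Require Import structures.
From mathcomp Require Import all_boot all_order all_algebra.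
From mathcomp Require Import boolp classical_sets reals.
From mathcomp Require Import lra.

Set Implicit Arguments.
Unset Strict Implicit.
Unset Printing Implicit Defensive.

Import Order.TTheory GRing.Theory Num.Theory.

Local Open Scope classical_set_scope.
Local Open Scope ring_scope.

(** Everything rests on the pairing of cost matrices with transport plans by
    [frob], a nondegenerate symmetric bilinear form.

    A consistent cost [c'] is bounded below by [alpha k] on all couplings and
    takes that value at [pi k].  Since [pi k] is a convex combination of the
    [u k l] with positive weights, [c'] takes the value [alpha k] at each
    [u k l] ([cost_on_plan_family]).  Hence the difference of two consistent
    costs is orthogonal to the whole system.  If the system spans the space of
    matrices, that difference is orthogonal to itself, so it vanishes: this is
    part a).

    For part b), if the system does not span, some [d != 0] is orthogonal to it
    ([exists_orthogonal]).  The cost [c + t *: d] still has the value [alpha k]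
    at [pi k], and it is consistent as soon as it is bounded below by [alpha k]
    on the couplings.  This holds for all small [t > 0]
    ([perturbed_lower_bound]), because the problem is finite: a linear
    functional on the couplings is bounded below by its values on the basic
    ones ([basic_below]), of which there is at most one for each support
    ([basic_inj]).  At a basic coupling, either [c] strictly exceeds [alpha k],
    which leaves room for a small [t], or the coupling is optimal, hence in the
    convex hull of the [u k l], where [d] vanishes.  So [c] is not the only
    consistent cost. *)

(** * The Frobenius pairing *)

Section Frobenius.
Variables (R : realType) (N M : nat).
Implicit Types A B C d : 'M[R]_(N, M).

Lemma frobC A B : frob A B = frob B A.
Proof. by apply: eq_bigr => i _; apply: eq_bigr => j _; rewrite mulrC. Qed.

Lemma frob_is_scalar A : scalar (frob A).
Proof.
move=> t B C; rewrite /frob mulr_sumr -big_split /=.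
apply: eq_bigr => i _; rewrite mulr_sumr -big_split /=.
by apply: eq_bigr => j _; rewrite !mxE mulrDr mulrCA.
Qed.

HB.instance Definition _ A := GRing.isLinear.Build R 'M[R]_(N, M) R
  *%R (frob A) (frob_is_scalar A).

Lemma frobDZl A d (t : R) B : frob (A + t *: d) B = frob A B + t * frob d B.
Proof. by rewrite frobC linearD linearZ /= !(frobC B). Qed.

Lemma frob_eq0 A : frob A A = 0 -> A = 0.
Proof.
move=> A0; apply/matrixP => i j; rewrite mxE.
have sq_ge0 (x : R) : 0 <= x * x by rewrite -expr2 sqr_ge0.
have row0 : \sum_j A i j * A i j = 0.
  by apply: (psumr_eq0P _ A0) => // k _; apply: sumr_ge0.
have /eqP : A i j * A i j = 0 by apply: (psumr_eq0P _ row0).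
by rewrite mulf_eq0 orbb => /eqP.
Qed.

(** A projection along [U] onto a complement is nonzero with kernel [U]; any
    nonzero coordinate of it is a linear form vanishing on [U], and every
    linear form on matrices is [frob d] for the matrix [d] of its values on the
    elementary matrices. *)
Lemma exists_orthogonal (U : {vspace 'M[R]_(N, M)}) :
  U != fullv -> exists2 d, d != 0 & forall B, B \in U -> frob d B = 0.
Proof.
move=> Uproper; pose p := projv U.
have [x xU] : exists x, x \notin U.
  apply: contrapT => noout; case/negP: Uproper; rewrite eqEsubv subvf /=.
  apply/subvP => x _; apply: contrapT => /negP xU; apply: noout.
  by exists x.
pose f B := B - p B.
have [i [j fx]] : exists i j, f x i j != 0.
  apply: contrapT => f0; case/negP: xU.
  have -> : x = p x.
    apply/eqP; rewrite -subr_eq0; apply/eqP/matrixP => i j; rewrite [RHS]mxE.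
    by apply: contrapT => /eqP fij; apply: f0; exists i, j.
  by have := memv_img p (memvf x); rewrite limg_proj.
pose d : 'M[R]_(N, M) := \matrix_(k, l) f (delta_mx k l) i j.
have frobd B : frob d B = f B i j.
  rewrite /f {2 3}(matrix_sum_delta B) linear_sum /= -sumrB summxE.
  apply: eq_bigr => k _; rewrite linear_sum /= -sumrB summxE.
  by apply: eq_bigr => l _; rewrite linearZ /= /d /f !mxE; lra.
exists d.
  apply: contraNneq fx => d0; rewrite -frobd d0 frobC.
  by apply/eqP; apply: linear0.
by move=> B BU; rewrite frobd /f projv_id // subrr mxE.
Qed.

End Frobenius.

Lemma free_subfamily (K : fieldType) (V : vectType K) (X : seq V) :
  exists s : seq V,
    [/\ free s, {subset s <= X} & <<s>>%VS = <<X>>%VS].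
Proof.
elim: X => [|x X [s [sfree sX sspan]]].
  by exists [::]; split; rewrite ?nil_free.
have [xs|xs] := boolP (x \in <<s>>%VS).
  exists s; split => //.
    by move=> y /sX yX; rewrite inE yX orbT.
  rewrite span_cons -sspan; apply/esym/addv_idPr.
  by rewrite -memvE.
exists (x :: s); split.
- by rewrite free_cons xs.
- by move=> y; rewrite !inE => /orP[->//|/sX ->]; rewrite orbT.
- by rewrite !span_cons sspan.
Qed.

(** * Basic couplings *)

Section Basic.
Variables (R : realType) (N M : nat).
Implicit Types (p q v c d : 'M[R]_(N, M)) (mu : 'rV[R]_N) (nu : 'rV[R]_M).

Definition mxsupp q : {set 'I_N * 'I_M} := [set ij | q ij.1 ij.2 != 0].

(** The directions along which a coupling can move without changing its
    marginals. *)
Definition balanced v : Prop :=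
  (forall i, \sum_j v i j = 0) /\ (forall j, \sum_i v i j = 0).

(** For couplings these are the vertices, in the form of the basic feasible
    solutions of linear programming. *)
Definition basic q : Prop :=
  forall v, balanced v -> mxsupp v \subset mxsupp q -> v = 0.

Lemma balancedN v : balanced v -> balanced (- v).
Proof.
by case=> r0 c0; split=> [i|j]; under eq_bigr do rewrite mxE;
  rewrite sumrN ?r0 ?c0 oppr0.
Qed.

Lemma mxsuppN v : mxsupp (- v) = mxsupp v.
Proof. by apply/setP => ij; rewrite !inE mxE oppr_eq0. Qed.

Lemma balancedB mu nu p q :
  couplings mu nu p -> couplings mu nu q -> balanced (p - q).
Proof.
case=> _ pr pc [_ qr qc]; split=> [i|j].
  by under eq_bigr do rewrite !mxE; rewrite sumrB pr qr subrr.
by under eq_bigr do rewrite !mxE; rewrite sumrB pc qc subrr.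
Qed.

(** The difference of two such couplings is a balanced direction supported in
    their common support. *)
Lemma basic_inj mu nu p q : couplings mu nu p -> couplings mu nu q ->
  basic p -> mxsupp p = mxsupp q -> p = q.
Proof.
move=> cp cq bp pq; apply/eqP; rewrite -subr_eq0; apply/eqP/bp.
  exact: balancedB cp cq.
apply/fintype.subsetP => -[i j]; apply: contraLR => pij; have := pij.
rewrite {1}pq !inE !mxE /= in pij * => /negPn/eqP ->.
by move: pij => /negPn/eqP ->; rewrite subrr eqxx.
Qed.

Lemma balanced_neg_entry v :
  balanced v -> v != 0 -> exists ij : 'I_N * 'I_M, v ij.1 ij.2 < 0.
Proof.
case=> r0 _ v0; apply: contrapT => noneg; case/eqP: v0.
have v_ge0 i j : 0 <= v i j.
  by rewrite leNgt; apply/negP => vij; apply: noneg; exists (i, j).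
apply/matrixP => i j; rewrite mxE.
by apply: (psumr_eq0P _ (r0 i)).
Qed.

(** Moving along [v] until the first entry of [q] hits [0]. *)
Lemma support_reduction mu nu q v : couplings mu nu q ->
  balanced v -> v != 0 -> mxsupp v \subset mxsupp q ->
  exists a : R, [/\ 0 < a, couplings mu nu (q + a *: v) &
                    mxsupp (q + a *: v) \proper mxsupp q].
Proof.
move=> [q_ge0 qr qc] bv v0 vq.
have [ij0 neg0] := balanced_neg_entry bv v0.
(* [q ij / - v ij] is the time at which the decreasing entry [ij] vanishes *)
pose time (ij : 'I_N * 'I_M) := q ij.1 ij.2 / - v ij.1 ij.2.
have [[i0 j0] /= vneg tmin] :=
  @arg_minP _ _ _ ij0 (fun ij => v ij.1 ij.2 < 0) time neg0.
have q0 : q i0 j0 != 0.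
  have := fintype.subsetP vq (i0, j0); rewrite !inE /=; apply.
  by rewrite lt_eqF.
pose a := time (i0, j0); exists a; split.
- by rewrite divr_gt0 ?oppr_gt0 // lt_def q0 q_ge0.
- case: bv => r0 c0; split.
  + move=> i j; rewrite !mxE; have [vij|vij] := ltP (v i j) 0.
      have := tmin (i, j) vij; rewrite /= -/a /time /= ler_pdivlMr ?oppr_gt0 //.
      by lra.
    by rewrite addr_ge0 // mulr_ge0 // divr_ge0 // oppr_ge0 ltW.
  + by move=> i; under eq_bigr do rewrite !mxE;
      rewrite big_split /= -mulr_sumr r0 mulr0 addr0.
  + by move=> j; under eq_bigr do rewrite !mxE;
      rewrite big_split /= -mulr_sumr c0 mulr0 addr0.
- apply/properP; split.
    apply/fintype.subsetP => -[i j]; apply: contraLR => qij.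
    have vij : (i, j) \notin mxsupp v.
      by apply: contra qij; apply: (fintype.subsetP vq).
    move: qij vij; rewrite !inE !mxE /= => /negPn/eqP-> /negPn/eqP->.
    by rewrite mulr0 addr0 eqxx.
  exists (i0, j0); rewrite inE //= !mxE /a /time /= negbK.
  by rewrite invrN mulrN mulNr divfK ?subrr // ltr0_neq0.
Qed.

(** A coupling that is not basic can move along some direction or its opposite
    without increasing the cost, and reach a smaller support. *)
Lemma basic_below mu nu c q : couplings mu nu q ->
  exists p, [/\ couplings mu nu p, basic p & frob c p <= frob c q].
Proof.
have [n] := ubnP #|mxsupp q|; elim: n q => // n IHn q + cq.
rewrite ltnS => qn.
have [bq|nbq] := EM (basic q); first by exists q.
have [v [bv vq v0]] : exists v, [/\ balanced v, mxsupp v \subset mxsupp q & v != 0].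
  apply: contrapT => nov; apply: nbq => v bv vq.
  by apply: contrapT => /eqP v0; apply: nov; exists v.
wlog cv : v bv vq v0 / frob c v <= 0.
  move=> H; have [cv|cv] := leP (frob c v) 0; first exact: (H v).
  apply: (H (- v)); rewrite ?mxsuppN ?oppr_eq0 //; first exact: balancedN.
  by rewrite linearN /= oppr_le0 ltW.
have [a [a_gt0 ca sa]] := support_reduction cq bv v0 vq.
have [|p [cp bp pq]] := IHn _ _ ca.
  exact: leq_trans (proper_card sa) qn.
exists p; split=> //; apply: (le_trans pq).
by rewrite linearD linearZ /= gerDl pmulr_rle0.
Qed.

End Basic.

(** * Perturbation of the cost *)

Section Perturbation.
Variable R : realType.

Lemma uniform_small (I : finType) (P : I -> R -> Prop) :
  (forall i, exists2 e : R, 0 < e & forall t : R, 0 < t -> t <= e -> P i t) ->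
  exists2 e : R, 0 < e & forall t : R, 0 < t -> t <= e -> forall i, P i t.
Proof.
move=> smallP; have [e e_gt0 Pe] : exists2 e : I -> R, forall i, 0 < e i &
    forall i (t : R), 0 < t -> t <= e i -> P i t.
  have /choice[e eP] : forall i, exists e : R, 0 < e /\
      forall t : R, 0 < t -> t <= e -> P i t.
    by move=> i; have [e ? ?] := smallP i; exists e.
  by exists e => i; case: (eP i).
exists (\big[Num.min/1]_i e i).
  by elim/big_ind: _ => // x y x0 y0; rewrite lt_min x0.
move=> t t0 te i; apply: Pe => //; apply: le_trans te _.
exact: bigmin_le.
Qed.

Lemma small_perturbation (x y : R) : 0 <= x -> (x = 0 -> 0 <= y) ->
  exists2 e : R, 0 < e & forall t : R, 0 < t -> t <= e -> 0 <= x + t * y.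
Proof.
move=> x_ge0 y0; have [y_ge0|y_lt0] := leP 0 y.
  by exists 1 => // t t0 _; rewrite addr_ge0 // mulr_ge0 // ltW.
have x_gt0 : 0 < x.
  by rewrite lt_def x_ge0 andbT; apply: contraTneq y_lt0 => /y0; rewrite leNgt.
exists (x / - y); first by rewrite divr_gt0 ?oppr_gt0.
by move=> t t0; rewrite ler_pdivlMr ?oppr_gt0 //; lra.
Qed.

(** Only the basic couplings need to be checked, and they are finitely many, so
    a common bound on [t] exists. *)
Lemma perturbed_lower_bound (N M : nat) (mu : 'rV[R]_N) (nu : 'rV[R]_M)
    (c d : 'M[R]_(N, M)) (a : R) :
  (forall q, couplings mu nu q -> a <= frob c q) ->
  (forall q, couplings mu nu q -> frob c q = a -> 0 <= frob d q) ->
  exists2 e : R, 0 < e & forall t : R, 0 < t -> t <= e ->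
    forall q, couplings mu nu q -> a <= frob (c + t *: d) q.
Proof.
move=> ca da.
pose P (S : {set 'I_N * 'I_M}) t := forall p, couplings mu nu p -> basic p ->
  mxsupp p = S -> a <= frob (c + t *: d) p.
have [S|e e_gt0 eP] := uniform_small (P := P).
  have [[p [cp bp pS]]|nop] := EM (exists p, [/\ couplings mu nu p, basic p &
      mxsupp p = S]); last first.
    by exists 1 => // t _ _ p cp bp pS; case: nop; exists p.
  have [||e e_gt0 eP] := small_perturbation (x := frob c p - a) (y := frob d p).
  - by rewrite subr_ge0 ca.
  - by move/eqP; rewrite subr_eq0 => /eqP; apply: da.
  exists e => // t t0 te q cq bq qS.
  have <- : p = q by apply: (basic_inj cp cq) => //; rewrite pS.
  by rewrite frobDZl; have := eP t t0 te; lra.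
exists e => // t t0 te q cq.
have [p [cp bp pq]] := basic_below (c + t *: d) cq.
by apply: le_trans pq; apply: (eP t t0 te (mxsupp p)).
Qed.

End Perturbation.

(** * Identifiability *)

Section Identifiability.
Variables (R : realType) (N M : nat).
Implicit Types (c d : 'M[R]_(N, M)) (mu : 'rV[R]_N) (nu : 'rV[R]_M).

(** A weighted average, with positive weights, of numbers that are at least [a]
    can only equal [a] if all of them do. *)
Lemma cost_on_plan_family c0 c mu nu p n (u : 'I_n -> 'M[R]_(N, M)) (a : R) :
  plan_family c0 mu nu p u -> is_transport_cost c mu nu a -> a = frob c p ->
  forall l, frob c (u l) = a.
Proof.
case=> uEP [lam [_ lam1] [lam_gt0 pE]] _ [_ amin] ap l.
have gap_ge0 k : 0 <= lam 0 k * (frob c (u k) - a).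
  apply: mulr_ge0; first exact: ltW.
  rewrite subr_ge0; apply: amin.
  by exists (u k) => //; case: (uEP k).
have gap0 : \sum_k lam 0 k * (frob c (u k) - a) = 0.
  under eq_bigr do rewrite mulrBr.
  rewrite sumrB -mulr_suml lam1 mul1r; apply/eqP; rewrite subr_eq0 ap pE.
  by rewrite linear_sum /=; under [X in _ == X]eq_bigr do rewrite linearZ.
have /eqP : lam 0 l * (frob c (u l) - a) = 0 by apply: (psumr_eq0P _ gap0).
by rewrite mulf_eq0 gt_eqF //= subr_eq0 => /eqP.
Qed.

Lemma frob_conv_family0 d n (u : 'I_n -> 'M[R]_(N, M)) q :
  (forall l, frob d (u l) = 0) -> conv_family u q -> frob d q = 0.
Proof.
move=> du [lam _ <-]; rewrite linear_sum big1 // => l _.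
by rewrite linearZ /= du mulr0.
Qed.

(** [N * M] is the dimension of the space, so that many independent members
    form a spanning subfamily; by duality, spanning means that only [0] is
    orthogonal to the family. *)
Lemma contains_freeP (K : nat) (L : 'I_K -> nat)
    (u : forall k : 'I_K, 'I_(L k) -> 'M[R]_(N, M)) :
  contains_free u (N * M)%N <->
  (forall d, (forall k l, frob d (u k l) = 0) -> d = 0).
Proof.
split=> [[s [sfree su]] d du|orth0]; last first.
  pose X := [seq u k l | k <- enum 'I_K, l <- enum 'I_(L k)].
  have uX k l : u k l \in X by apply/allpairsPdep; exists k, l; rewrite !mem_enum.
  have [s [sfree sX sspan]] := free_subfamily X.
  have full : <<X>>%VS = fullv.
    apply/eqP/negPn/negP => /exists_orthogonal[d d0 dX]; case/eqP: d0.
    by apply: orth0 => k l; apply/dX/memv_span/uX.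
  have size_s : size s == (N * M)%N.
    by rewrite -(eqP sfree) sspan full dimvf.
  exists (Tuple size_s); split=> // v /sX /allpairsPdep[k [l [_ _ ->]]].
  by exists k, l.
have full : <<s>>%VS = fullv.
  by apply/eqP; rewrite eqEdim subvf /= dimvf (eqP sfree) size_tuple.
apply: frob_eq0; have : d \in <<s>>%VS by rewrite full memvf.
move/coord_span => dE; rewrite {2}dE linear_sum big1 // => i _.
have /su[k [l ->]] : s`_i \in s by rewrite mem_nth ?size_tuple.
by rewrite linearZ /= du mulr0.
Qed.

End Identifiability.

Theorem theorem2p25 (R : realType) (K N M : nat)
    (mu : 'I_K -> 'rV[R]_N) (nu : 'I_K -> 'rV[R]_M)
    (alpha : 'I_K -> R) (pi : 'I_K -> 'M[R]_(N, M)) (c : 'M[R]_(N, M))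
    (L : 'I_K -> nat) (u : forall k : 'I_K, 'I_(L k) -> 'M[R]_(N, M))
    (hmu : forall k, simplex R N (mu k))
    (hnu : forall k, simplex R M (nu k))
    (hdistinct : injective (fun k => (mu k, nu k)))
    (hpi : forall k, couplings (mu k) (nu k) (pi k))
    (hobs : forall k, is_transport_cost c (mu k) (nu k) (alpha k)
                      /\ alpha k = frob c (pi k))
    (hu : forall k, plan_family c (mu k) (nu k) (pi k) (u k)) :
  (contains_free u (N * M)%N -> identifiable mu nu alpha pi c)
  /\
  ((forall k, conv_family (u k) = OTP c (mu k) (nu k)) ->
   identifiable mu nu alpha pi c -> contains_free u (N * M)%N).
Proof.
split=> [/contains_freeP orth0|convE ident].
  apply/seteqP; split=> [c' /= c'cons|_ ->]; last exact: hobs.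
  apply/eqP; rewrite -subr_eq0; apply/eqP/orth0 => k l.
  have [cost plan] := c'cons k; have [cost0 plan0] := hobs k.
  rewrite -scaleN1r frobDZl (cost_on_plan_family (hu k) cost plan).
  by rewrite (cost_on_plan_family (hu k) cost0 plan0) mulN1r subrr.
apply/contains_freeP => d du.
have d_pi k : frob d (pi k) = 0.
  apply: (frob_conv_family0 (du k)).
  by have [_ [lam lamS [_ ->]] _] := hu k; exists lam.
have alpha_le k q : couplings (mu k) (nu k) q -> alpha k <= frob c q.
  by move=> cq; have [[_ amin] _] := hobs k; apply: amin; exists q.
have [k|e e_gt0 eP] := @uniform_small R _ (fun k t => forall q,
    couplings (mu k) (nu k) q -> alpha k <= frob (c + t *: d) q).
  apply: perturbed_lower_bound => [|q cq qalpha]; first exact: alpha_le.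
  rewrite (frob_conv_family0 (du k)) // convE; split=> // r /alpha_le.
  by rewrite qalpha.
have : [set c' | consistent mu nu alpha pi c'] (c + e *: d).
  move=> k; have pi_cost : frob (c + e *: d) (pi k) = alpha k.
    by rewrite frobDZl d_pi mulr0 addr0; case: (hobs k).
  split=> //; split; first by exists (pi k).
  by move=> _ [q cq <-]; apply: eP.
rewrite ident => /= /eqP; rewrite addrC -subr_eq0 addrK scaler_eq0 gt_eqF //=.
by move/eqP.
Qed.
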